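(* Let $\widetilde\Gamma(x)=\frac1x e^{x\log 2}\prod_{k=1}^\infty\left(e^{-x/k}(1+x/k)\right)^{(-1)^{k+1}}$. For $\mathrm{Re}(x)>0$, $$\widetilde\Gamma(x)=\lim_{\substack{n\to\infty\\ n\ \text{even}}}\frac{n!!}{(n-1)!!}\prod_{k=0}^{n}\left(\frac1{k+x}\right)^{(-1)^k}=\lim_{\substack{n\to\infty\\ n\ \text{odd}}}\frac{(n-1)!!}{n!!}\prod_{k=0}^{n}\left(\frac1{k+x}\right)^{(-1)^k}.$$
   Context: In the product defining $\widetilde\Gamma$, for odd $k$ the factor is $e^{-x/k}(1+x/k)$ and for even $k$ it is its reciprocal. $m!!$ denotes the double factorial, with $0!!=1$. *)

(* Defs.v *)
From Stdlib Require Import Reals Arith.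
From Coquelicot Require Import Coquelicot.

Open Scope R_scope.
Open Scope C_scope.

Definition Cexp (z : C) : C :=
  RtoC (exp (Re z)) * (cos (Im z), sin (Im z)).

Fixpoint dfact (n : nat) : nat :=
  match n with
  | O | S O => 1
  | S (S m as p) => S p * dfact m
  end%nat.

(* Product of [f k] over [0 <= k < n] (the bound [n] is excluded, unlike in
   [sum_n]). *)
Fixpoint Cprod (f : nat -> C) (n : nat) : C :=
  match n with
  | O => 1
  | S m => Cprod f m * f m
  end.

(* [z ^ ((-1) ^ k)]: the integer exponent is 1 for even [k], -1 for odd [k]. *)
Definition Calt (k : nat) (z : C) : C :=
  if Nat.even k then z else / z.

(* Limit of a complex sequence; arbitrary value if there is none. *)
Definition C_lim_seq (u : nat -> C) : C :=
  C_complete_lim (filtermap u eventually).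

(* Infinite product of [f k] over [k >= 1], as the limit of its partial
   products. *)
Definition Cinfprod1 (f : nat -> C) : C :=
  C_lim_seq (Cprod (fun j => f (S j))).

Definition tGamma (x : C) : C :=
  1 / x * Cexp (x * RtoC (ln 2)) *
  Cinfprod1 (fun k =>
    Calt (k + 1) (Cexp (- x / RtoC (INR k)) * (1 + x / RtoC (INR k)))).

(* Main.v *)
(** Write [P n] for the [n]-th partial product in the definition of [tGamma]
    and [H n] for the [n]-th partial sum of [1 - 1/2 + 1/3 - ...]. Collecting
    the exponentials, and the factors [k] into double factorials, the [n]-th
    term of either sequence equals [1/x * exp (x * H n) * P n] exactly. Since
    [H n] tends to [ln 2], only the convergence of [P n] remains; it follows
    from [|exp w - 1 - w| <= M |w|^2] with [w = x/k], which makes both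
    [exp (-w) (1 + w)] and its inverse [1 + O(1/k^2)] when [Re x > 0]. *)

Require Import Defs.
From Stdlib Require Import Reals Arith Lra Lia.
From Coquelicot Require Import Coquelicot.
Open Scope R_scope.
Open Scope C_scope.

(** * Parity, non-vanishing and double factorials *)

Lemma Calt_even n z : Nat.even n = true -> Calt n z = z.
Proof. unfold Calt; intros ->; reflexivity. Qed.

Lemma Calt_odd n z : Nat.even n = false -> Calt n z = / z.
Proof. unfold Calt; intros ->; reflexivity. Qed.

Lemma even_S n : Nat.even (S n) = negb (Nat.even n).
Proof. rewrite Nat.even_succ, <- Nat.negb_even; reflexivity. Qed.

Lemma RtoC_neq0 r : r <> 0%R -> RtoC r <> 0.
Proof. intros Hr H; apply Hr; injection H; trivial. Qed.

Lemma Re_neq0 z : Re z <> 0%R -> z <> 0.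
Proof. intros H ->; apply H; reflexivity. Qed.

Lemma dfact_SS n : dfact (S (S n)) = (S (S n) * dfact n)%nat.
Proof. reflexivity. Qed.

Lemma dfact_pos n : (0 < dfact n)%nat.
Proof.
  (* The recursion of [dfact] steps by two, so the induction carries two consecutive indices. *)
  enough (0 < dfact n /\ 0 < dfact (S n))%nat by tauto.
  induction n as [|n [IH1 IH2]]; [simpl; lia|].
  split; [exact IH2|]. rewrite dfact_SS; nia.
Qed.

Lemma RtoC_dfact_neq0 n : RtoC (INR (dfact n)) <> 0.
Proof. apply RtoC_neq0, not_0_INR; pose proof (dfact_pos n); lia. Qed.

(** * The complex exponential *)

Lemma Cexp_plus u v : Cexp (u + v) = Cexp u * Cexp v.
Proof.
  unfold Cexp; destruct u as [a b], v as [c d]; simpl.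
  rewrite exp_plus, cos_plus, sin_plus.
  apply injective_projections; simpl; ring.
Qed.

Lemma Cexp_0 : Cexp 0 = 1.
Proof.
  unfold Cexp; simpl; rewrite exp_0, cos_0, sin_0.
  apply injective_projections; simpl; ring.
Qed.

Lemma Cexp_neq0 z : Cexp z <> 0.
Proof.
  intros H. apply C1_nz. rewrite <- Cexp_0.
  replace (RtoC 0) with (z + - z) by ring.
  rewrite Cexp_plus, H; ring.
Qed.

Lemma Cexp_opp z : Cexp (- z) = / Cexp z.
Proof.
  assert (E : Cexp z * Cexp (- z) = 1).
  { rewrite <- Cexp_plus, <- Cexp_0; f_equal; ring. }
  transitivity (/ Cexp z * (Cexp z * Cexp (- z))).
  - field; apply Cexp_neq0.
  - rewrite E; ring.
Qed.

Lemma Cmod_Cexp z : Cmod (Cexp z) = exp (Re z).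
Proof.
  unfold Cexp; rewrite Cmod_mult, Cmod_R, Rabs_pos_eq by (left; apply exp_pos).
  unfold Cmod; simpl fst; simpl snd.
  replace (cos (Im z) ^ 2 + sin (Im z) ^ 2)%R with 1%R.
  - rewrite sqrt_1; ring.
  - rewrite <- (sin2_cos2 (Im z)); unfold Rsqr; ring.
Qed.

(** * Real bounds behind the second-order estimate of the exponential *)

Local Open Scope R_scope.

(** Mean value theorem with [|cos| <= 1]; using it on a ball around 0 treats both signs of [b] at
    once. *)
Lemma Rabs_sin_le b : Rabs (sin b) <= Rabs b.
Proof.
  destruct (MVT_cor4 sin cos 0 (Rabs b)) with (b := b) as [c [E _]].
  - intros c _; auto_derive; [trivial|ring].
  - rewrite Rminus_0_r; lra.
  - rewrite sin_0, !Rminus_0_r in E. rewrite E, Rabs_mult.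
    pose proof (Rabs_pos b). assert (Rabs (cos c) <= 1) by apply Rabs_le, COS_bound.
    nra.
Qed.

(** The half-angle form turns bounds on [sin (b / 2)] into both a quadratic and a linear bound. *)
Lemma cos_minus_1 b : cos b - 1 = - (2 * (sin (b / 2) * sin (b / 2))).
Proof.
  replace b with (2 * (b / 2)) at 1 by field.
  rewrite cos_2a_sin; ring.
Qed.

Lemma Rabs_cos_minus_1_le_sqr b : Rabs (cos b - 1) <= b * b.
Proof.
  rewrite cos_minus_1, Rabs_Ropp, Rabs_pos_eq by nra.
  pose proof (Rabs_sin_le (b / 2)) as H.
  apply Rsqr_le_abs_1 in H; unfold Rsqr in H; nra.
Qed.

Lemma Rabs_cos_minus_1_le b : Rabs (cos b - 1) <= Rabs b.
Proof.
  rewrite cos_minus_1, Rabs_Ropp, Rabs_pos_eq by nra.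
  pose proof (Rabs_sin_le (b / 2)) as H.
  rewrite (Rabs_div b 2), (Rabs_pos_eq 2) in H by lra.
  assert (Rabs (sin (b / 2)) <= 1) by apply Rabs_le, SIN_bound.
  assert (E : sin (b / 2) * sin (b / 2) = Rabs (sin (b / 2)) * Rabs (sin (b / 2))).
  { rewrite <- Rabs_mult, Rabs_pos_eq; nra. }
  pose proof (Rabs_pos (sin (b / 2))). nra.
Qed.

(** Mean value theorem for [sin t - t]: by the linear bound, its derivative at [c] is at most
    [|c| <= |b|] in absolute value. *)
Lemma Rabs_sin_minus_le b : Rabs (sin b - b) <= b * b.
Proof.
  destruct (MVT_cor4 (fun t => sin t - t) (fun t => cos t - 1) 0 (Rabs b))
    with (b := b) as [c [E Hc]].
  - intros c _; auto_derive; [trivial|ring].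
  - rewrite Rminus_0_r; lra.
  - rewrite sin_0, !Rminus_0_r in *. rewrite E, Rabs_mult.
    pose proof (Rabs_cos_minus_1_le c). pose proof (Rabs_pos b).
    replace (b * b) with (Rabs b * Rabs b) by (rewrite <- Rabs_mult, Rabs_pos_eq; nra).
    nra.
Qed.

Lemma exp_le a b : a <= b -> exp a <= exp b.
Proof. intros [H| ->]; [left; apply exp_increasing, H|right; reflexivity]. Qed.

(** This is [1 - a <= exp (- a)] multiplied by [exp a]. *)
Lemma exp_minus_1_le a : exp a - 1 <= a * exp a.
Proof.
  pose proof (exp_ineq1_le (- a)). pose proof (exp_pos a).
  assert (exp a * exp (- a) = 1).
  { rewrite <- exp_plus, Rplus_opp_r; apply exp_0. }
  nra.
Qed.

(** Real and imaginary parts are bounded separately. With [a * |b| <= r^2 / 2] and [1 <= exp a] the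
    bounds add up to [5/2 * exp a * r^2]; the constant 5 leaves slack. *)
Lemma Cmod_Cexp_taylor2 z :
  0 <= Re z -> Cmod (Cexp z - 1 - z) <= 5 * exp (Re z) * (Cmod z * Cmod z).
Proof.
  destruct z as [a b]; intros Ha; simpl in *.
  set (r := Cmod (a, b)).
  assert (Hr : a * a + b * b = r * r).
  { unfold r, Cmod; simpl fst; simpl snd. rewrite sqrt_sqrt; nra. }
  pose proof (exp_ineq1_le a). pose proof (exp_minus_1_le a).
  pose proof (exp_pos a) as He.
  assert (Hre : Rabs (exp a * cos b - 1 - a) <= a * a * exp a + exp a * (b * b)).
  { replace (exp a * cos b - 1 - a)
      with ((exp a - 1 - a) + exp a * (cos b - 1)) by ring.
    eapply Rle_trans; [apply Rabs_triang|]. apply Rplus_le_compat.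
    (* [exp a - 1 - a <= a * (exp a - 1) <= a * (a * exp a)], by [exp_minus_1_le] twice and
       [a >= 0]. *)
    - rewrite Rabs_pos_eq; nra.
    - rewrite Rabs_mult, (Rabs_pos_eq (exp a)) by lra.
      apply Rmult_le_compat_l; [lra|apply Rabs_cos_minus_1_le_sqr]. }
  assert (Him : Rabs (exp a * sin b - b) <= a * exp a * Rabs b + b * b).
  { replace (exp a * sin b - b)
      with ((exp a - 1) * sin b + (sin b - b)) by ring.
    eapply Rle_trans; [apply Rabs_triang|]. apply Rplus_le_compat.
    - rewrite Rabs_mult, Rabs_pos_eq by lra.
      apply Rmult_le_compat; [lra|apply Rabs_pos|lra|apply Rabs_sin_le].
    - apply Rabs_sin_minus_le. }
  assert (Hb : 2 * (a * Rabs b) <= a * a + b * b).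
  { assert (Rabs b * Rabs b = b * b) by (rewrite <- Rabs_mult, Rabs_pos_eq; nra).
    pose proof (Rle_0_sqr (a - Rabs b)); unfold Rsqr in *; nra. }
  assert (Hm : Cmod (Cexp (a, b) - 1 - (a, b))%C
    <= Rabs (exp a * cos b - 1 - a) + Rabs (exp a * sin b - b)).
  { replace (Cexp (a, b) - 1 - (a, b))%C
      with (RtoC (exp a * cos b - 1 - a) + Ci * RtoC (exp a * sin b - b))%C.
    - eapply Rle_trans; [apply Cmod_triangle|].
      rewrite Cmod_mult, !Cmod_R, Cmod_Ci; lra.
    - unfold Cexp; apply injective_projections; simpl; ring. }
  assert (0 <= exp a * (r * r)) by nra.
  nra.
Qed.

Local Open Scope C_scope.

(** * Limits in [C] *)

(* [filterlim_mult] lives in the uniform structure that [Cmod] puts on [C];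
   the canonical one is that of the product [R * R]. *)
Lemma filterlim_Cmult {T} (F : (T -> Prop) -> Prop) {FF : Filter F}
  (f g : T -> C) (u v : C) :
  filterlim f F (locally u) -> filterlim g F (locally v) ->
  filterlim (fun t => f t * g t) F (locally (u * v)).
Proof.
  intros Hf Hg.
  assert (L : forall w, filter_le (locally (T := AbsRing_UniformSpace C_AbsRing) w)
                          (locally (T := C_UniformSpace) w)).
  { intros w P HP; apply locally_C; exact HP. }
  assert (L' : forall w, filter_le (locally (T := C_UniformSpace) w)
                          (locally (T := AbsRing_UniformSpace C_AbsRing) w)).
  { intros w P HP; apply locally_C; exact HP. }
  eapply filterlim_filter_le_2; [apply L|].
  refine (filterlim_comp_2 f g Cmult _ _ (@filterlim_mult C_AbsRing u v)).
  - eapply filterlim_filter_le_2; [apply L'|exact Hf].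
  - eapply filterlim_filter_le_2; [apply L'|exact Hg].
Qed.

Lemma filterlim_Cpair {T} (F : (T -> Prop) -> Prop) {FF : Filter F}
  (f g : T -> R) (u v : R) :
  filterlim f F (locally u) -> filterlim g F (locally v) ->
  filterlim (fun t => (f t, g t) : C) F (locally ((u, v) : C)).
Proof.
  intros Hf Hg. apply filterlim_locally. intros eps.
  pose proof (proj1 (filterlim_locally f u) Hf eps) as A.
  pose proof (proj1 (filterlim_locally g v) Hg eps) as B.
  generalize (filter_and _ _ A B). apply filter_imp.
  intros t [a b]; split; assumption.
Qed.

(** Only a real factor varies, so continuity reduces to that of two differentiable real functions,
    the coordinates of the exponential. *)
Lemma filterlim_Cexp_scal (z : C) (s : nat -> R) (l : R) :
  is_lim_seq s l ->
  filterlim (fun n => Cexp (z * RtoC (s n))) eventually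
    (locally (Cexp (z * RtoC l))).
Proof.
  intros Hs.
  assert (E : forall r, Cexp (z * RtoC r)
    = (exp (Re z * r) * cos (Im z * r), exp (Re z * r) * sin (Im z * r))%R).
  { intros r; destruct z as [a b]; unfold Cexp; simpl.
    replace (a * r - b * 0)%R with (a * r)%R by ring.
    replace (a * 0 + b * r)%R with (b * r)%R by ring.
    apply injective_projections; simpl; ring. }
  rewrite E. eapply filterlim_ext; [intros n; symmetry; apply E|].
  assert (K : forall h : R -> R, continuous h l ->
    filterlim (fun n => h (s n)) eventually (locally (h l))).
  { intros h Hh. eapply filterlim_comp; [exact Hs|exact Hh]. }
  apply (filterlim_Cpair eventually).
  - apply (K (fun r => exp (Re z * r) * cos (Im z * r))%R).
    apply (ex_derive_continuous (V := R_NormedModule)). auto_derive; trivial.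
  - apply (K (fun r => exp (Re z * r) * sin (Im z * r))%R).
    apply (ex_derive_continuous (V := R_NormedModule)). auto_derive; trivial.
Qed.

(** A convergent sequence generates a proper Cauchy filter, so by completeness the chosen point is a
    genuine limit and not the arbitrary default. *)
Lemma C_lim_seq_correct (u : nat -> C) (l : C) :
  filterlim u eventually (locally l) ->
  filterlim u eventually (locally (C_lim_seq u)).
Proof.
  intros H. apply filterlim_locally. intros eps.
  apply (C_complete_ax1 (filtermap u eventually)).
  - apply filtermap_proper_filter, eventually_filter.
  - intros e; exists l. apply (proj1 (filterlim_locally u l) H e).
Qed.

(** * Convergence of infinite products *)

(** Since [1 + b n <= exp (b n)], the partial products are bounded by [exp B]. The increments
    [Cprod f n * (f n - 1)] are then dominated by [exp B * b n], so their series converges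
    absolutely. *)
Lemma Cprod_cv (f : nat -> C) (b : nat -> R) :
  (forall n, Cmod (f n - 1) <= b n)%R -> ex_series b ->
  exists l, filterlim (Cprod f) eventually (locally l).
Proof.
  intros Hb [B HB].
  assert (b0 : forall n, (0 <= b n)%R).
  { intros n; eapply Rle_trans; [apply Cmod_ge_0|apply Hb]. }
  assert (Hs : forall n, (sum_n b n <= B)%R).
  { apply is_lim_seq_incr_compare; [exact HB|].
    intros n; rewrite sum_Sn; unfold plus; simpl; specialize (b0 (S n)); lra. }
  assert (step : forall n y, (Cmod (Cprod f n) <= exp y ->
                   Cmod (Cprod f (S n)) <= exp (y + b n))%R).
  { intros n y Hy; simpl; rewrite Cmod_mult, exp_plus.
    apply Rmult_le_compat; [apply Cmod_ge_0|apply Cmod_ge_0|exact Hy|].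
    replace (f n) with (1 + (f n - 1)) by ring.
    eapply Rle_trans; [apply Cmod_triangle|].
    rewrite Cmod_1. eapply Rle_trans; [|apply exp_ineq1_le].
    apply Rplus_le_compat_l, Hb. }
  assert (HS : forall n, (Cmod (Cprod f (S n)) <= exp (sum_n b n))%R).
  { induction n as [|n IH].
    - rewrite sum_O. rewrite <- (Rplus_0_l (b 0%nat)). apply step.
      simpl; rewrite Cmod_1, exp_0; lra.
    - rewrite sum_Sn. apply step, IH. }
  assert (HP : forall n, (Cmod (Cprod f n) <= exp B)%R).
  { intros [|n].
    - simpl; rewrite Cmod_1, <- exp_0. apply exp_le.
      specialize (Hs 0%nat); rewrite sum_O in Hs; specialize (b0 0%nat); lra.
    - eapply Rle_trans; [apply HS|apply exp_le, Hs]. }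
  destruct (@ex_series_le C_AbsRing C_CompleteNormedModule
              (fun n => Cprod f n * (f n - 1)) (fun n => exp B * b n)%R) as [l Hl].
  - intros n. change (Cmod (Cprod f n * (f n - 1)) <= exp B * b n)%R.
    rewrite Cmod_mult.
    apply Rmult_le_compat; try apply Cmod_ge_0; [apply HP|apply Hb].
  - apply (ex_series_scal (V := R_NormedModule)). exists B; exact HB.
  (* The increments telescope to [Cprod f (S n) - 1], as the empty product is 1. *)
  - exists (l + 1).
    assert (E : forall n, sum_n (fun n => Cprod f n * (f n - 1) : C_CompleteNormedModule) n
                          = Cprod f (S n) - 1).
    { induction n as [|n IH].
      - rewrite sum_O; simpl; ring.
      - rewrite sum_Sn, IH. unfold plus; simpl; ring. }
    assert (L : filterlim (fun n => Cprod f (S n)) eventually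
                  (locally (plus l (RtoC 1)))).
    { apply filterlim_ext with (fun n =>
        plus (sum_n (fun n => Cprod f n * (f n - 1) : C_CompleteNormedModule) n) (RtoC 1)).
      - intros n; rewrite E. unfold plus; simpl; ring.
      - refine (filterlim_comp_2 _ _ plus Hl (filterlim_const _)
                  (@filterlim_plus C_AbsRing C_NormedModule l (RtoC 1))). }
    intros P Pl. destruct (L P Pl) as [N HN]. exists (S N).
    intros [|n] Hn; [lia|]. apply HN; lia.
Qed.

Lemma filterlim_eventually_ge (phi : nat -> nat) :
  (forall n, n <= phi n)%nat -> filterlim phi eventually eventually.
Proof.
  intros H P [N HN]. exists N. intros n Hn. apply HN. specialize (H n); lia.
Qed.

Lemma is_lim_seq_inv_S : is_lim_seq (fun n => / INR (S n))%R 0%R.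
Proof.
  apply (is_lim_seq_incr_1 (fun n => / INR n)%R).
  apply (is_lim_seq_inv INR p_infty); [apply is_lim_seq_INR|discriminate].
Qed.

(** Comparison with a telescoping series: [1/k^2 <= 2/(k (k+1)) = 2 (1/k - 1/(k+1))] for
    [k >= 1]. *)
Lemma ex_series_inv_sqr (M : R) :
  (0 <= M)%R -> ex_series (fun j => M * / (INR (S j) * INR (S j)))%R.
Proof.
  intros HM.
  apply (ex_series_scal (V := R_NormedModule)) with (c := M).
  apply (@ex_series_le R_AbsRing R_CompleteNormedModule _
           (fun j => 2 * (/ INR (S j) - / INR (S (S j)))))%R.
  - intros j. unfold norm; simpl norm.
    change (Rabs (/ (INR (S j) * INR (S j))) <= 2 * (/ INR (S j) - / INR (S (S j))))%R.
    pose proof (pos_INR j). rewrite !S_INR.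
    rewrite Rabs_pos_eq by (left; apply Rinv_0_lt_compat; nra).
    replace (2 * (/ (INR j + 1) - / (INR j + 1 + 1)))%R
      with (2 / ((INR j + 1) * (INR j + 2)))%R by (field; lra).
    apply (Rmult_le_reg_r ((INR j + 1) * (INR j + 1) * (INR j + 2))); [nra|].
    replace (/ ((INR j + 1) * (INR j + 1)) * ((INR j + 1) * (INR j + 1) * (INR j + 2)))%R
      with (INR j + 2)%R by (field; lra).
    replace (2 / ((INR j + 1) * (INR j + 2)) * ((INR j + 1) * (INR j + 1) * (INR j + 2)))%R
      with (2 * (INR j + 1))%R by (field; lra).
    lra.
  - apply (ex_series_scal (V := R_NormedModule)) with (c := 2%R).
    exists 1%R.
    change (is_lim_seq (sum_n (fun j => / INR (S j) - / INR (S (S j)))%R) 1%R).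
    apply is_lim_seq_ext with (fun n => 1 - / INR (S (S n)))%R.
    + induction n as [|n IH].
      * rewrite sum_O; simpl; field.
      * rewrite sum_Sn, <- IH. unfold plus; cbn [AbelianMonoid.plus]; simpl; ring.
    + replace (Finite 1) with (Finite (1 - 0)) by (f_equal; ring).
      apply is_lim_seq_minus'; [apply is_lim_seq_const|].
      apply (is_lim_seq_incr_1 (fun n => / INR (S n))%R), is_lim_seq_inv_S.
Qed.

(** * The alternating harmonic series *)

Fixpoint harm (n : nat) : R :=
  match n with O => 0 | S m => harm m + / INR (S m) end%R.

(** The [H n] of the overview. The index is shifted: even [m] contributes the odd denominator
    [m + 1], hence the plus sign. *)
Fixpoint altharm (n : nat) : R :=
  match n with
  | O => 0
  | S m => altharm m + (if Nat.even m then 1 else -1) * / INR (S m)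
  end%R.

(** Flipping the signs of the even denominators subtracts twice [1/2 + 1/4 + ... + 1/(2n)], which is
    [harm n]. *)
Lemma altharm_double n : altharm (2 * n) = (harm (2 * n) - harm n)%R.
Proof.
  induction n as [|n IH]; [simpl; ring|].
  replace (2 * S n)%nat with (S (S (2 * n))) by lia.
  cbn [altharm harm]. rewrite IH.
  assert (Ev : Nat.even (2 * n) = true) by (apply Nat.even_spec; exists n; lia).
  rewrite even_S, Ev; simpl negb; cbv iota.
  replace (INR (S (S (2 * n)))) with (2 * INR (S n))%R.
  - field. split; apply not_0_INR; lia.
  - replace (S (S (2 * n))) with (2 * S n)%nat by lia. rewrite mult_INR; reflexivity.
Qed.

(* The limit is the Euler-Mascheroni constant, but its value cancels in
   [altharm_double]. *)
Lemma harm_minus_ln_cv : ex_finite_lim_seq (fun n => harm (S n) - ln (INR (S n)))%R.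
Proof.
  assert (Hln : forall t, (0 < t -> ln t <= t - 1)%R).
  { intros t Ht. pose proof (exp_ineq1_le (ln t)). rewrite exp_ln in *; lra. }
  assert (Hinv : forall n, (0 < / INR (S n))%R).
  { intros n; apply Rinv_0_lt_compat, lt_0_INR; lia. }
  assert (Hp : forall n, (0 < INR (S n))%R) by (intros n; apply lt_0_INR; lia).
  (* Both conditions come from [ln t <= t - 1]: at [t = k/(k+1)] it gives the decrease, at
     [t = (k+1)/k] the lower bound 0. *)
  apply ex_finite_lim_seq_decr with 0%R.
  - intros n. cbn [harm].
    assert (H := Hln (INR (S n) / INR (S (S n)))%R).
    assert (E : (INR (S n) / INR (S (S n)) = 1 - / INR (S (S n)))%R).
    { rewrite (S_INR (S n)). specialize (Hp n). field. lra. }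
    rewrite ln_div in H by apply Hp. rewrite E in H.
    enough (0 < 1 - / INR (S (S n)))%R by lra.
    rewrite <- E. apply Rdiv_lt_0_compat; apply Hp.
  - intros n.
    enough (ln (INR (S n)) <= harm n)%R by (cbn [harm]; specialize (Hinv n); lra).
    induction n as [|n IH]; [simpl; rewrite ln_1; lra|].
    cbn [harm].
    assert (H := Hln (INR (S (S n)) / INR (S n))%R).
    assert (E : (INR (S (S n)) / INR (S n) = 1 + / INR (S n))%R).
    { rewrite (S_INR (S n)). specialize (Hp n). field. lra. }
    rewrite ln_div in H by apply Hp. rewrite E in H. specialize (Hinv n). lra.
Qed.

Lemma is_lim_seq_even_odd (u : nat -> R) (l : R) :
  is_lim_seq (fun n => u (2 * n)%nat) l ->
  is_lim_seq (fun n => u (S (2 * n))) l -> is_lim_seq u l.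
Proof.
  intros He Ho. apply is_lim_seq_spec in He, Ho. apply is_lim_seq_spec.
  intros eps. destruct (He eps) as [N1 H1], (Ho eps) as [N2 H2].
  exists (2 * (N1 + N2) + 1)%nat. intros n Hn.
  destruct (Nat.Even_or_Odd n) as [[m ->]|[m ->]].
  - apply H1; lia.
  - replace (2 * m + 1)%nat with (S (2 * m)) by lia. apply H2; lia.
Qed.

(** By [altharm_double], an even term is the difference of [harm - ln] at [2n] and at [n], plus
    [ln (2n) - ln n = ln 2]. An odd term differs from the preceding even one by [1/(2n+1)]. *)
Lemma altharm_lim : is_lim_seq altharm (ln 2).
Proof.
  destruct harm_minus_ln_cv as [g Hg].
  assert (He : is_lim_seq (fun n => altharm (2 * n)) (ln 2)).
  (* The shift to [n + 1] keeps the arguments of the logarithms positive. *)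
  { apply is_lim_seq_incr_1.
    apply is_lim_seq_ext with (fun n =>
      (harm (S (S (2 * n))) - ln (INR (S (S (2 * n)))))
      - (harm (S n) - ln (INR (S n))) + ln 2)%R.
    - intros n. rewrite altharm_double.
      replace (2 * S n)%nat with (S (S (2 * n))) by lia.
      replace (INR (S (S (2 * n)))) with (2 * INR (S n))%R.
      + rewrite ln_mult; [ring|lra|apply lt_0_INR; lia].
      + replace (S (S (2 * n))) with (2 * S n)%nat by lia.
        rewrite mult_INR; reflexivity.
    - replace (Finite (ln 2)) with (Finite (g - g + ln 2)) by (f_equal; ring).
      apply is_lim_seq_plus'; [apply is_lim_seq_minus'|apply is_lim_seq_const].
      + apply (is_lim_seq_subseq (fun n => harm (S n) - ln (INR (S n)))%R _
                 (fun n => S (2 * n))); [apply filterlim_eventually_ge; lia|exact Hg].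
      + exact Hg. }
  apply is_lim_seq_even_odd; [exact He|].
  apply is_lim_seq_ext with (fun n => altharm (2 * n) + / INR (S (2 * n)))%R.
  - intros n. cbn [altharm].
    assert (Ev : Nat.even (2 * n) = true) by (apply Nat.even_spec; exists n; lia).
    rewrite Ev; ring.
  - replace (Finite (ln 2)) with (Finite (ln 2 + 0)) by (f_equal; ring).
    apply is_lim_seq_plus'; [exact He|].
    apply (is_lim_seq_subseq (fun n => / INR (S n))%R _ (fun n => 2 * n)%nat);
      [apply filterlim_eventually_ge; lia|apply is_lim_seq_inv_S].
Qed.

(** * The product *)

Definition tGamma_factor (x : C) (k : nat) : C :=
  Calt (k + 1) (Cexp (- x / RtoC (INR k)) * (1 + x / RtoC (INR k))).

(** In both parities the difference from 1 is [exp w - 1 - w] times a number of modulus at most 1: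
    [- exp (- w)] or [1 / (1 + w)]. This is where [Re w > 0] enters. *)
Lemma Cmod_alt_factor_minus_1 n w :
  (0 < Re w)%R ->
  (Cmod (Calt n (Cexp (- w) * (1 + w)) - 1)
   <= 5 * exp (Re w) * (Cmod w * Cmod w))%R.
Proof.
  intros Hw.
  eapply Rle_trans; [|apply Cmod_Cexp_taylor2; lra].
  assert (W : 1 + w <> 0) by (apply Re_neq0; destruct w; simpl in *; lra).
  assert (W1 : (1 <= Cmod (1 + w))%R).
  { eapply Rle_trans; [|apply re_le_Cmod].
    eapply Rle_trans; [|apply Rle_abs]. destruct w; simpl in *; lra. }
  pose proof (Cexp_neq0 w).
  pose proof (Cmod_ge_0 (Cexp w - 1 - w)).
  destruct (Nat.even n) eqn:E.
  - rewrite (Calt_even _ _ E), Cexp_opp.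
    replace (/ Cexp w * (1 + w) - 1) with (Cexp (- w) * - (Cexp w - 1 - w))
      by (rewrite Cexp_opp; field; assumption).
    rewrite Cmod_mult, Cmod_opp, Cmod_Cexp.
    assert (exp (Re (- w)) <= 1)%R.
    { rewrite <- exp_0. apply exp_le. destruct w; simpl in *; lra. }
    nra.
  - rewrite (Calt_odd _ _ E), Cexp_opp.
    replace (/ (/ Cexp w * (1 + w)) - 1) with (/ (1 + w) * (Cexp w - 1 - w))
      by (field; split; assumption).
    rewrite Cmod_mult, Cmod_inv by assumption.
    pose proof (Rinv_le_contravar 1 _ Rlt_0_1 W1) as W2. rewrite Rinv_1 in W2.
    nra.
Qed.

(** With [w = x/k] and [k >= 1], [exp (Re w) <= exp (Re x)], so the factors are within a constant
    times [1/k^2] of 1. *)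
Lemma tGamma_product_cv x :
  (0 < Re x)%R ->
  filterlim (Cprod (fun j => tGamma_factor x (S j))) eventually
    (locally (Cinfprod1 (tGamma_factor x))).
Proof.
  intros Hx.
  destruct (Cprod_cv (fun j => tGamma_factor x (S j))
    (fun j => 5 * exp (Re x) * (Cmod x * Cmod x) * / (INR (S j) * INR (S j)))%R)
    as [l Hl].
  - intros j. unfold tGamma_factor.
    assert (Hk : (1 <= INR (S j))%R) by (rewrite S_INR; pose proof (pos_INR j); lra).
    set (k := INR (S j)) in *.
    set (w := x / RtoC k).
    assert (Hw : Re w = (Re x / k)%R).
    { unfold w; destruct x as [a b]; unfold Cdiv; rewrite <- RtoC_inv by lra.
      simpl. field. lra. }
    assert (Hm : Cmod w = (Cmod x / k)%R).
    { unfold w; rewrite Cmod_div by (apply RtoC_neq0; lra).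
      rewrite Cmod_R, Rabs_pos_eq by lra; reflexivity. }
    replace (- x / RtoC k) with (- w) by (unfold w; field; apply RtoC_neq0; lra).
    eapply Rle_trans; [apply Cmod_alt_factor_minus_1|].
    + rewrite Hw; apply Rdiv_lt_0_compat; lra.
    + rewrite Hm.
      replace (Cmod x / k * (Cmod x / k))%R
        with (Cmod x * Cmod x * / (k * k))%R by (field; lra).
      rewrite <- !Rmult_assoc. rewrite !(Rmult_assoc (5 * _)).
      apply Rmult_le_compat_r.
      * apply Rmult_le_pos; [|left; apply Rinv_0_lt_compat; nra].
        pose proof (Cmod_ge_0 x); nra.
      * apply Rmult_le_compat_l; [lra|]. apply exp_le. rewrite Hw.
        apply (Rmult_le_reg_r k); [lra|].
        replace (Re x / k * k)%R with (Re x) by (field; lra). nra.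
  - apply ex_series_inv_sqr. pose proof (exp_pos (Re x)). pose proof (Cmod_ge_0 x).
    apply Rmult_le_pos; nra.
  - apply (C_lim_seq_correct _ l). exact Hl.
Qed.

(** * The finite identity and the two limits *)

(** Merges the even and odd prefactors of the theorem, so that one limit serves both. At [n = 0]
    truncated subtraction makes the value 1. *)
Definition dfact_ratio (n : nat) : C :=
  Calt n (RtoC (INR (dfact n)) / RtoC (INR (dfact (n - 1)))).

(** As [(n+1)!! = (n+1) (n-1)!!], the plain quotient at [n + 1] is [n + 1] divided by the one at
    [n]; the alternating exponent turns this division into a product. *)
Lemma dfact_ratio_S n :
  dfact_ratio (S n) = Calt (S n) (RtoC (INR (S n))) * dfact_ratio n.
Proof.
  assert (HS : RtoC (INR (S n)) <> 0) by (apply RtoC_neq0, not_0_INR; lia).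
  assert (R : RtoC (INR (dfact (S n)))
              = RtoC (INR (S n)) * RtoC (INR (dfact (n - 1)))).
  { rewrite <- RtoC_mult, <- mult_INR. destruct n as [|n].
    - reflexivity.
    - replace (S n - 1)%nat with n by lia. reflexivity. }
  pose proof (RtoC_dfact_neq0 n). pose proof (RtoC_dfact_neq0 (n - 1)).
  unfold dfact_ratio. replace (S n - 1)%nat with n by lia. rewrite R.
  destruct (Nat.even n) eqn:E.
  - assert (E' : Nat.even (S n) = false) by (rewrite even_S, E; reflexivity).
    rewrite !(Calt_odd _ _ E'), (Calt_even _ _ E). field. auto.
  - assert (E' : Nat.even (S n) = true) by (rewrite even_S, E; reflexivity).
    rewrite !(Calt_even _ _ E'), (Calt_odd _ _ E). field. auto.
Qed.

(** Induction on [n]. With [k = n + 1], each step multiplies both sides by [(k/(k+x))^((-1)^k)]: on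
    the right, the new term of [altharm] cancels the exponential in the new factor. *)
Lemma finite_product_eq x n :
  (0 < Re x)%R ->
  dfact_ratio n * Cprod (fun k => Calt k (1 / (RtoC (INR k) + x))) (n + 1)
  = 1 / x * Cexp (x * RtoC (altharm n))
    * Cprod (fun j => tGamma_factor x (S j)) n.
Proof.
  intros Hx. assert (x0 : x <> 0) by (apply Re_neq0; lra).
  replace (n + 1)%nat with (S n) by lia.
  induction n as [|n IH].
  (* Both sides are [1/x], which on the left is the factor at [k = 0]. *)
  - unfold dfact_ratio, Calt; simpl.
    rewrite Cmult_0_r, Cexp_0. field. exact x0.
  - rewrite dfact_ratio_S.
    change (Cprod (fun k => Calt k (1 / (RtoC (INR k) + x))) (S (S n)))
      with (Cprod (fun k => Calt k (1 / (RtoC (INR k) + x))) (S n)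
            * Calt (S n) (1 / (RtoC (INR (S n)) + x))).
    change (Cprod (fun j => tGamma_factor x (S j)) (S n))
      with (Cprod (fun j => tGamma_factor x (S j)) n * tGamma_factor x (S n)).
    unfold tGamma_factor at 2. cbn [altharm].
    replace (S n + 1)%nat with (S (S n)) by lia.
    assert (HS : (0 < INR (S n))%R) by (apply lt_0_INR; lia).
    set (k := INR (S n)) in *.
    assert (k0 : RtoC k <> 0) by (apply RtoC_neq0; lra).
    assert (kx : RtoC k + x <> 0) by (apply Re_neq0; destruct x; simpl in *; lra).
    transitivity (Calt (S n) (RtoC k) * Calt (S n) (1 / (RtoC k + x))
      * (dfact_ratio n * Cprod (fun k => Calt k (1 / (RtoC (INR k) + x))) (S n)));
      [ring|].
    rewrite IH. rewrite RtoC_plus, RtoC_mult, RtoC_inv by lra.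
    pose proof (Cexp_neq0 (x / RtoC k)).
    replace (- x / RtoC k) with (- (x / RtoC k)) by (field; exact k0).
    rewrite Cexp_opp.
    destruct (Nat.even n) eqn:E.
    + assert (E' : Nat.even (S n) = false) by (rewrite even_S, E; reflexivity).
      assert (E2 : Nat.even (S (S n)) = true) by (rewrite even_S, E'; reflexivity).
      rewrite !(Calt_odd _ _ E'), (Calt_even _ _ E2).
      replace (x * (RtoC (altharm n) + 1 * / RtoC k))
        with (x * RtoC (altharm n) + x / RtoC k) by (field; exact k0).
      rewrite Cexp_plus. field. auto.
    + assert (E' : Nat.even (S n) = true) by (rewrite even_S, E; reflexivity).
      assert (E2 : Nat.even (S (S n)) = false) by (rewrite even_S, E'; reflexivity).
      rewrite !(Calt_even _ _ E'), (Calt_odd _ _ E2).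
      replace (RtoC (-1)) with (- RtoC 1) by (rewrite <- RtoC_opp; reflexivity).
      replace (x * (RtoC (altharm n) + - (1) * / RtoC k))
        with (x * RtoC (altharm n) + - (x / RtoC k)) by (field; exact k0).
      rewrite Cexp_plus, Cexp_opp. field. repeat split; auto.
Qed.

Theorem theorem2p8 :
  forall x : C, (0 < Re x)%R ->
    filterlim
      (fun n : nat =>
         RtoC (INR (dfact n)) / RtoC (INR (dfact (n - 1))) *
         Cprod (fun k => Calt k (1 / (RtoC (INR k) + x))) (n + 1))
      (within Nat.Even eventually) (locally (tGamma x))
    /\
    filterlim
      (fun n : nat =>
         RtoC (INR (dfact (n - 1))) / RtoC (INR (dfact n)) *
         Cprod (fun k => Calt k (1 / (RtoC (INR k) + x))) (n + 1))
      (within Nat.Odd eventually) (locally (tGamma x)).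
Proof.
  intros x Hx.
  assert (L : filterlim (fun n => dfact_ratio n
      * Cprod (fun k => Calt k (1 / (RtoC (INR k) + x))) (n + 1))
    eventually (locally (tGamma x))).
  { eapply filterlim_ext; [intros n; symmetry; apply finite_product_eq, Hx|].
    unfold tGamma. apply (filterlim_Cmult eventually); [|apply tGamma_product_cv, Hx].
    apply (filterlim_Cmult eventually); [apply filterlim_const|].
    apply filterlim_Cexp_scal, altharm_lim. }
  (* The merged sequence converges along all [n], so it also does along each parity, where its
     prefactor is the stated one. *)
  assert (W : forall D, filter_le (within D eventually) eventually).
  { intros D P; unfold within; apply filter_imp; auto. }
  split.
  - eapply filterlim_within_ext; [|eapply filterlim_filter_le_1; [apply W|exact L]].
    intros n Hn. apply Nat.even_spec in Hn.
    unfold dfact_ratio. rewrite (Calt_even _ _ Hn). reflexivity.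
  - eapply filterlim_within_ext; [|eapply filterlim_filter_le_1; [apply W|exact L]].
    intros n Hn. apply Nat.odd_spec in Hn. rewrite <- Nat.negb_even in Hn.
    apply Bool.negb_true_iff in Hn.
    unfold dfact_ratio. rewrite (Calt_odd _ _ Hn). f_equal.
    pose proof (RtoC_dfact_neq0 n). pose proof (RtoC_dfact_neq0 (n - 1)).
    field; auto.
Qed.
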